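(* Let $\alpha,\beta>0$, and let $\mathbf{F}_{\mathbf n}:\mathbb{R}^6\to\mathbb{R}^6$ be the directional flux, in the variables $\mathbf u=(f,b,\eta,g,q,\zeta)^\top$, $$\mathbf{F}_{\mathbf n}(\mathbf u)=\Bigl(\tfrac{\alpha}{2}f^2b,\ \tfrac{\alpha}{2}f(b^2+\eta^2),\ 0,\ \alpha fgb+\tfrac{\beta}{2}g^2q,\ \tfrac{\beta}{2}g(q^2+\zeta^2)+\alpha f(bq+\eta\zeta),\ 0\Bigr)^\top ,$$ with Jacobian $\mathbf A_{\mathbf n}(\mathbf u)=\partial \mathbf F_{\mathbf n}(\mathbf u)/\partial\mathbf u$. Put $$|\mathbf b|=\sqrt{b^2+\eta^2},\quad |\mathbf q|=\sqrt{q^2+\zeta^2},\quad \sigma=\alpha fb+\beta gq,\quad \delta_\pm=\beta gq\pm\tfrac{\alpha f}{2}|\mathbf b|,$$ $$\Delta_\pm=\delta_\pm^2-\tfrac{\beta^2g^2}{4}|\mathbf q|^2,\qquad \Delta_0=\sigma^2-\tfrac{\beta^2g^2}{4}|\mathbf q|^2 .$$ Then: (i) $\mathbf A_{\mathbf n}(\mathbf u)$ has six real eigenvalues (counted with algebraic multiplicity), namely $$\tilde\lambda_{1,2}=\alpha fb\pm\tfrac{\alpha f}{2}|\mathbf b|,\qquad \tilde\lambda_{3,4}=\sigma\pm\tfrac{\beta g}{2}|\mathbf q|,\qquad \tilde\lambda_{5,6}=0 .$$ (ii) If $\Delta_0\ne0$, $f>0$, $|\mathbf b|\neq0$ and $3b^2\ne\eta^2$,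 then the eigenvalue $0$ of $\mathbf A_{\mathbf n}(\mathbf u)$ has geometric multiplicity $2$. (iii) If $f>0$, $g>0$, $|\mathbf b|\ne0$, $|\mathbf q|\neq0$, $\Delta_+\ne0$, $\Delta_-\neq0$, $\Delta_0\ne0$ and $3b^2\neq\eta^2$, then $\mathbf A_{\mathbf n}(\mathbf u)$ has six linearly independent real eigenvectors, i.e. it is diagonalizable over $\mathbb R$.
   Context: The two-dimensional two-layer thin film system, for film heights $f,g$ and concentration gradients $\mathbf b,\mathbf q\in\mathbb R^2$, is $$\partial_t f+\nabla\cdot\bigl(\tfrac{\alpha}{2} f^2\mathbf b\bigr)=0,\quad \partial_t\mathbf b+\nabla\cdot\bigl(\tfrac{\alpha}{2} f|\mathbf b|^2\mathbf I\bigr)=0,\quad \partial_t g+\nabla\cdot\bigl(\alpha fg\,\mathbf b+\tfrac{\beta}{2} g^2\mathbf q\bigr)=0,$$ $$\partial_t\mathbf q+\nabla\cdot\bigl((\tfrac{\beta}{2} g|\mathbf q|^2+\alpha f\,\mathbf b\cdot\mathbf q)\mathbf I\bigr)=0,$$ where $\alpha,\beta>0$ are the Marangoni numbers and $\mathbf I$ is the $2\times2$ identity matrix. Given a unit vector $\mathbf n\in\mathbb R^2$ and a unit vector $\mathbf t$ orthogonal to $\mathbf n$, write $b=\mathbf b\cdot\mathbf n$, $\eta=\mathbf b\cdot\mathbf t$, $q=\mathbf q\cdot\mathbf n$, $\zeta=\mathbf q\cdot\mathbf t$. For solutions depending in space only on $x=\mathbf x\cdot\mathbf n$, the system becomes the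 one-dimensional system $\mathbf u_t+\mathbf F_{\mathbf n}(\mathbf u)_x=0$ with the flux $\mathbf F_{\mathbf n}$ given in the claim (the formula for $\mathbf F_{\mathbf n}$ is the same for every $\mathbf n$ in these variables). A one-dimensional system is called hyperbolic at a state if its flux Jacobian is diagonalizable there with real eigenvalues. *)

(* Defs.v *)
From HB Require Import structures.
From mathcomp Require Import all_boot all_order all_algebra.
From mathcomp Require Import boolp classical_sets functions reals.
From mathcomp Require Import topology normedtype derive.

Set Implicit Arguments.
Unset Strict Implicit.
Unset Printing Implicit Defensive.

Import Order.TTheory GRing.Theory Num.Theory numFieldNormedType.Exports.
Local Open Scope ring_scope.

Section Defs.
Variable R : realType.
Implicit Types (alpha beta f b eta g q zeta : R).

Definition vec6 (x0 x1 x2 x3 x4 x5 : R) : 'rV[R]_6 :=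
  \row_(i < 6) [:: x0; x1; x2; x3; x4; x5]`_i.

(* The numerals below are elements of 'I_6 (integers modulo 6), so that
   u = vec6 (u 0 0) (u 0 1) ... (u 0 5). *)
Definition flux alpha beta (u : 'rV[R]_6) : 'rV[R]_6 :=
  let f := u 0 0 in let b := u 0 1 in let eta := u 0 2 in
  let g := u 0 3 in let q := u 0 4 in let zeta := u 0 5 in
  vec6 (alpha / 2 * f ^+ 2 * b)
       (alpha / 2 * f * (b ^+ 2 + eta ^+ 2))
       0
       (alpha * f * g * b + beta / 2 * g ^+ 2 * q)
       (beta / 2 * g * (q ^+ 2 + zeta ^+ 2)
          + alpha * f * (b * q + eta * zeta))
       0.

(* [jacobian F u] represents the differential acting on row vectors from the
   right, v |-> v *m jacobian F u; the usual matrix (d F_i / d u_j)_(i, j),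
   acting on column vectors, is its transpose. *)
Definition flux_jacobian alpha beta (u : 'rV[R]_6) : 'M[R]_6 :=
  (jacobian (flux alpha beta) u)^T.

(* [eigenspace] consists of row vectors v with v *m M = a *: v, hence the
   transpose to count the column vectors v with A *m v = a *: v. *)
Definition geometric_multiplicity n (A : 'M[R]_n) (a : R) : nat :=
  \rank (eigenspace A^T a).

End Defs.

(* Main.v *)
Require Import Defs.
From HB Require Import structures.
From mathcomp Require Import all_boot all_order all_algebra.
From mathcomp Require Import ring.
From mathcomp Require Import boolp classical_sets functions reals.
From mathcomp Require Import topology normedtype derive.

Set Implicit Arguments.
Unset Strict Implicit.
Unset Printing Implicit Defensive.

Import Order.TTheory GRing.Theory Num.Theory numFieldNormedType.Exports.
Local Open Scope ring_scope.

(** The last three variables [(g, q, zeta)] do not enter the first three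
    components of the flux, so the Jacobian is block lower triangular with two
    [3 * 3] diagonal blocks, each with zero last row and equal first two
    diagonal entries; the eigenvalues [l1, l2, 0] and [l3, l4, 0] are read off
    these blocks. The hypotheses
    [3 * b ^+ 2 != eta ^+ 2] and [Delta_0 != 0] say that the leading [2 * 2]
    minors of the two blocks are nonzero, so the kernel is exactly the plane
    of dimension two forced by the two zero rows. Since
    [Delta_p = (l3 - l2) * (l4 - l2)], [Delta_m = (l3 - l1) * (l4 - l1)] and
    [Delta_0 = l3 * l4], in case (iii) the four other eigenvalues are distinct
    and nonzero, and the dimensions of the eigenspaces add up to six. *)

(** * Differentials by coordinates and the Jacobian of the flux *)

Lemma is_diff_coord (R : realFieldType) m n (M : 'M[R]_(m, n)) i j :
  is_diff M (fun N : 'M[R]_(m, n) => N i j : R) (fun N => N i j).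
Proof.
apply: DiffDef; first exact: differentiable_coord.
have lin : linear (fun N : 'M[R]_(m, n) => N i j : R).
  by move=> a u v; rewrite !mxE.
(* A continuous linear map is its own differential, so the coordinate is packed as a linear map. *)
pose linM := GRing.isLinear.Build _ _ _ _ _ lin.
pose f : {linear 'M[R]_(m, n) -> R} :=
  HB.pack (fun N : 'M[R]_(m, n) => N i j) linM.
by rewrite -[X in 'd X _]/(f : _ -> _) diff_lin //; exact: coord_continuous.
Qed.

Lemma is_diff_big_sum (R : realFieldType) (V W : normedModType R) (I : Type)
    (r : seq I) (f df : I -> V -> W) (x : V) :
  (forall i, is_diff x (f i) (df i)) ->
  is_diff x (\sum_(i <- r) f i) (\sum_(i <- r) df i).
Proof.
move=> dfx; elim: r => [|i r ih]; first by rewrite !big_nil; exact: is_diff_cst.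
by rewrite !big_cons; apply: is_diffD.
Qed.

(** A row-valued map is the sum of its coordinates times the basis vectors, so differentiation
    reduces to scalar functions. *)
Lemma is_diff_rV (R : realFieldType) (V : normedModType R) n
    (F dF : V -> 'rV[R]_n) (x : V) :
  (forall i, is_diff x (fun u => F u 0 i : R) (fun u => dF u 0 i)) ->
  is_diff x F dF.
Proof.
move=> dFx.
have sumE (G : V -> 'rV[R]_n) :
    G = \sum_(i < n) (fun u => G u 0 i *: delta_mx 0 i : 'rV[R]_n).
  by apply/funext => u; rewrite fct_sumE {1}[G u]row_sum_delta.
rewrite [F]sumE [dF]sumE; apply: is_diff_big_sum => i.
exact: (is_diff_comp (dFx i) (is_diff_scalel _ _)).
Qed.

Lemma jacobian_is_diff (R : realFieldType) m n (F : 'rV[R]_m -> 'rV[R]_n)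
    (M : 'M[R]_(m, n)) (x : 'rV[R]_m) :
  is_diff x F (mulmx^~ M) -> jacobian F x = M.
Proof.
move=> dF; apply/row_matrixP => i.
by rewrite !rowE -deriveEjacobian // deriveE // diff_val.
Qed.

Lemma big_ord6 (V : nmodType) (F : 'I_6 -> V) :
  \sum_(i < 6) F i = F 0 + F 1 + F 2 + F 3 + F 4 + F 5.
Proof.
rewrite !big_ord_recr big_ord0 /= add0r.
by do !congr (_ + _); congr F; apply: val_inj.
Qed.

(* Rows shorter than six are padded with zeros by [nth]. *)
Definition flux_matrix (F : fieldType) (alpha beta f b eta g q zeta : F) :
    'M[F]_6 :=
  \matrix_(i, j) (nth [::]
  [:: [:: alpha * f * b; alpha / 2 * f ^+ 2];
      [:: alpha / 2 * (b ^+ 2 + eta ^+ 2); alpha * f * b; alpha * f * eta];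
      [::];
      [:: alpha * g * b; alpha * f * g; 0;
          alpha * f * b + beta * g * q; beta / 2 * g ^+ 2];
      [:: alpha * (b * q + eta * zeta); alpha * f * q; alpha * f * zeta;
          beta / 2 * (q ^+ 2 + zeta ^+ 2); alpha * f * b + beta * g * q;
          alpha * f * eta + beta * g * zeta]] i)`_j.

Lemma flux_jacobianE (R : realType) (alpha beta f b eta g q zeta : R) :
  flux_jacobian alpha beta (vec6 f b eta g q zeta) =
  flux_matrix alpha beta f b eta g q zeta.
Proof.
apply: trmx_inj; rewrite trmxK; apply: jacobian_is_diff.
(* With the coordinates as functions, each flux component is a polynomial expression in the [c j],
   to which the sum and product rules apply. *)
pose c (j : 'I_6) := fun u : 'rV[R]_6 => u 0 j : R.
pose x := vec6 f b eta g q zeta.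
have dc j : is_diff x (c j) (c j) by exact: is_diff_coord.
have dcst k : is_diff x (cst k : _ -> R) (fun=> 0) by exact: is_diff_cst.
have [c0 c1 c2] : [/\ c 0 x = f, c 1 x = b & c 2 x = eta] by rewrite /c !mxE.
have [c3 c4 c5] : [/\ c 3 x = g, c 4 x = q & c 5 x = zeta] by rewrite /c !mxE.
have fluxE (u : 'rV[R]_6) : flux alpha beta u = vec6
    ((cst (alpha / 2) * c 0 ^+ 2 * c 1) u)
    ((cst (alpha / 2) * c 0 * (c 1 ^+ 2 + c 2 ^+ 2)) u) 0
    ((cst alpha * c 0 * c 3 * c 1 + cst (beta / 2) * c 3 ^+ 2 * c 4) u)
    ((cst (beta / 2) * c 3 * (c 4 ^+ 2 + c 5 ^+ 2)
      + cst alpha * c 0 * (c 1 * c 4 + c 2 * c 5)) u) 0 by [].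
(* The exponent in [is_diffX n] is [n.+1], so [is_diffX 1] differentiates a square. *)
have d0 := is_diffM (is_diffM (dcst (alpha / 2)) (is_diffX 1 (dc 0))) (dc 1).
have d1 := is_diffM (is_diffM (dcst (alpha / 2)) (dc 0))
  (is_diffD (is_diffX 1 (dc 1)) (is_diffX 1 (dc 2))).
have d3 := is_diffD
  (is_diffM (is_diffM (is_diffM (dcst alpha) (dc 0)) (dc 3)) (dc 1))
  (is_diffM (is_diffM (dcst (beta / 2)) (is_diffX 1 (dc 3))) (dc 4)).
have d4 := is_diffD
  (is_diffM (is_diffM (dcst (beta / 2)) (dc 3))
    (is_diffD (is_diffX 1 (dc 4)) (is_diffX 1 (dc 5))))
  (is_diffM (is_diffM (dcst alpha) (dc 0))
    (is_diffD (is_diffM (dc 1) (dc 4)) (is_diffM (dc 2) (dc 5)))).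
apply: is_diff_rV => i.
under eq_fun do rewrite fluxE mxE.
case: i => [[|[|[|[|[|[|//]]]]]] lt_i] /=;
  [apply: is_diff_eq d0 _ | apply: is_diff_eq d1 _
  | apply: is_diff_eq (dcst 0) _ | apply: is_diff_eq d3 _
  | apply: is_diff_eq d4 _ | apply: is_diff_eq (dcst 0) _];
  (* Each differential at [x] is compared with row [i] of [flux_matrix] paired with [u]. *)
  apply/funext => u; rewrite -/x mxE big_ord6 !mxE /= ?fctE;
  rewrite ?(c0, c1, c2, c3, c4, c5) /c /GRing.scale /=; by field.
Qed.

(** * Eigenspaces and diagonalizability *)

(** Eigenspaces for distinct eigenvalues are in direct sum, so their dimensions add up; once the
    total reaches [n] they fill the whole space. *)
Lemma diagonalizable_geometric_multiplicity (F : fieldType) n (A : 'M[F]_n)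
    (rs : seq F) :
  uniq rs -> (n <= \sum_(r <- rs) \rank (eigenspace A r))%N -> diagonalizable A.
Proof.
move=> urs len; apply/diagonalizablePeigen; exists rs => //.
suff full : row_full (\sum_(r <- rs) eigenspace A r)%MS.
  by apply/eqmxP; rewrite submx1 sub1mx.
have dir : mxdirect (\sum_(i < size rs) eigenspace A rs`_i).
  apply: mxdirect_sum_eigenspace => i j _ _ rsij; apply/val_inj.
  by apply: uniqP rsij; rewrite ?inE.
rewrite -col_leq_rank; apply: leq_trans len _.
by rewrite (big_nth 0) [X in \rank X](big_nth 0) !big_mkord (mxdirectP dir).
Qed.

(** The rows of the diagonalizing [P] are left eigenvectors. From [P A = D P] follows
    [A P^-1 = P^-1 D], so the columns of [invmx P] are right eigenvectors. *)
Lemma diagonalizable_col_eigenvectors (F : fieldType) n (A : 'M[F]_n) :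
  diagonalizable A ->
  exists2 v : n.-tuple 'cV[F]_n, free v &
    forall i : 'I_n, exists l : F, A *m tnth v i = l *: tnth v i.
Proof.
move=> [P Pu /diagonalizable_forPex[d /(simmxP Pu) PA]].
have AP : A *m invmx P = invmx P *m diag_mx d.
  by rewrite -[A](mulKmx Pu) PA mulmxA mulmxK.
exists [tuple col i (invmx P) | i < n] => [|i]; last first.
  exists (d 0 i); rewrite tnth_mktuple !colE mulmxA AP -mulmxA.
  rewrite [RHS]scalemxAr; congr (_ *m _); apply/colP => j.
  rewrite mul_diag_mx !mxE; have [->|_] := eqVneq j i; first by [].
  by rewrite !mulr0.
apply/freeP => k sum0.
(* A linear relation among the columns says that [invmx P] kills the coefficient vector, which then
   vanishes by invertibility. *)
have Pk0 : invmx P *m (\col_i k i) = 0.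
  rewrite -[RHS]sum0; apply/colP => i; rewrite summxE mxE.
  apply: eq_bigr => j _.
  by rewrite (nth_map j) ?size_enum_ord // nth_ord_enum !mxE mulrC.
have /colP k0 : \col_i k i = 0 :> 'cV_n.
  by rewrite -[LHS](mulKVmx Pu) Pk0 mulmx0.
by move=> i; have := k0 i; rewrite !mxE.
Qed.

(** A matrix and its transpose have equal rank, so left and right eigenspaces have the same
    dimension. *)
Lemma geometric_multiplicity_eigenspace (R : realType) n (A : 'M[R]_n) (a : R) :
  geometric_multiplicity A a = \rank (eigenspace A a).
Proof.
rewrite /geometric_multiplicity /eigenspace !mxrank_ker.
by rewrite -[a%:M in LHS]tr_scalar_mx -linearB /= mxrank_tr.
Qed.

(** * The characteristic polynomial *)

Lemma char_poly_lblock (R : comNzRingType) m n (A : 'M[R]_m) (C : 'M[R]_(n, m))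
    (D : 'M[R]_n) :
  char_poly (block_mx A 0 C D) = char_poly A * char_poly D.
Proof.
rewrite /char_poly -(det_lblock _ (- map_mx polyC C)); congr (\det _).
rewrite /char_poly_mx map_block_mx /= map_mx0 scalar_mx_block opp_block_mx.
by rewrite add_block_mx subr0 add0r.
Qed.

(** Expansion along the zero last row leaves [X ((X - a)^2 - m n)], and [m n = s^2] turns the second
    factor into a difference of squares. *)
Lemma char_poly_thin_block (R : comNzRingType) (a m n k s : R) :
  m * n = s ^+ 2 ->
  char_poly (\matrix_(i < 3, j < 3)
    (nth [::] [:: [:: a; m; 0]; [:: n; a; k]] i)`_j) =
  ('X - (a + s)%:P) * ('X - (a - s)%:P) * 'X.
Proof.
move=> /(congr1 polyC); rewrite polyCM polyC_exp => mn.
rewrite /char_poly (expand_det_row _ ord_max) !big_ord_recl big_ord0.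
rewrite !mxE /= /cofactor !(expand_det_row _ ord0) !big_ord_recl !big_ord0.
rewrite !mxE /= /cofactor !det_mx11 !mxE /= polyCD polyCB.
rewrite polyC0 !mulr0n !mulr1n /bump /=; ring: mn.
Qed.

Lemma char_poly_flux_matrix (R : realFieldType)
    (alpha beta f b eta g q zeta nb nq : R) :
  nb ^+ 2 = b ^+ 2 + eta ^+ 2 -> nq ^+ 2 = q ^+ 2 + zeta ^+ 2 ->
  let sigma := alpha * f * b + beta * g * q in
  char_poly (flux_matrix alpha beta f b eta g q zeta) =
  \prod_(l <- [:: alpha * f * b + alpha * f / 2 * nb;
                  alpha * f * b - alpha * f / 2 * nb;
                  sigma + beta * g / 2 * nq; sigma - beta * g / 2 * nq; 0; 0])
     ('X - l%:P).
Proof.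
move=> nbE nqE sigma; set M := flux_matrix _ _ _ _ _ _ _ _.
pose B : 'M[R]_3 := \matrix_(i, j) (nth [::]
  [:: [:: alpha * f * b; alpha / 2 * f ^+ 2; 0];
      [:: alpha / 2 * (b ^+ 2 + eta ^+ 2); alpha * f * b; alpha * f * eta]]
  i)`_j.
pose D : 'M[R]_3 := \matrix_(i, j) (nth [::]
  [:: [:: sigma; beta / 2 * g ^+ 2; 0];
      [:: beta / 2 * (q ^+ 2 + zeta ^+ 2); sigma;
          alpha * f * eta + beta * g * zeta]] i)`_j.
(* The sizes are explicit because [6] must be read as [3 + 3]. *)
have ME : M = block_mx B 0 (@dlsubmx _ 3 3 3 3 M) D.
  rewrite -[LHS](@submxK _ 3 3 3 3); congr (@block_mx _ 3 3 3 3 _ _ _ _);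
  by apply/matrixP => -[[|[|[|//]]] ?] -[[|[|[|//]]] ?]; rewrite !mxE.
have -> : char_poly M = char_poly B * char_poly D.
  by rewrite {1}ME; exact: (@char_poly_lblock R 3 3).
rewrite (@char_poly_thin_block _ _ _ _ _ (alpha * f / 2 * nb));
  last by rewrite exprMn nbE; field.
rewrite (@char_poly_thin_block _ _ _ _ _ (beta * g / 2 * nq)); last first.
  by rewrite exprMn nqE; field.
by rewrite !big_cons big_nil polyC0 subr0 mulr1; ring.
Qed.

(** * The kernel of the Jacobian *)

(** In [v *m M = 0], columns 3 and 4 involve only [v 0 3] and [v 0 4]; once these vanish, columns 0
    and 1 form a system in [v 0 0] and [v 0 1] alone. *)
Lemma rank_ker_flux_matrix (R : realFieldType)
    (alpha beta f b eta g q zeta : R) :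
  alpha != 0 -> f != 0 -> 3 * b ^+ 2 != eta ^+ 2 ->
  (alpha * f * b + beta * g * q) ^+ 2
    - beta ^+ 2 * g ^+ 2 / 4 * (q ^+ 2 + zeta ^+ 2) != 0 ->
  \rank (kermx (flux_matrix alpha beta f b eta g q zeta)) = 2%N.
Proof.
move=> a0 f0 be D0; set M := flux_matrix _ _ _ _ _ _ _ _.
pose K : 'M[R]_(1 + 1, 6) := col_mx (delta_mx 0 2) (delta_mx 0 5).
have rankK : \rank K = 2%N.
  (* The rows of [K] are orthonormal, so its transpose is a right inverse. *)
  apply/eqP/row_freeP; exists K^T; rewrite tr_col_mx mul_col_row !trmx_delta.
  rewrite !mul_delta_mx !mul_delta_mx_0 // [in RHS]scalar_mx_block.
  by congr block_mx; apply/matrixP => i j; rewrite !ord1 !mxE.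
apply: etrans rankK; apply/eqmx_rank/andP; split; last first.
  rewrite sub_kermx mul_col_mx -!rowE.
  have r0 i : i = 2 \/ i = 5 -> row i M = 0.
    by case=> ->; apply/rowP => j; rewrite !mxE /= nth_nil.
  by rewrite (r0 2 (or_introl erefl)) (r0 5 (or_intror erefl)) col_mx0.
apply/rV_subP => v /sub_kermxP /rowP vM.
(* Cramer's rule for a homogeneous system with equal diagonal entries [p]. *)
have solve2 (x y p r s : R) : p ^+ 2 - r * s != 0 ->
    x * p + y * r = 0 -> x * s + y * p = 0 -> x = 0 /\ y = 0.
  move=> det0 e1 e2; split; apply: (mulIf det0); rewrite mul0r.
    by transitivity (p * (x * p + y * r) - r * (x * s + y * p));
      [ring | rewrite e1 e2; ring].
  by transitivity (p * (x * s + y * p) - s * (x * p + y * r));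
    [ring | rewrite e1 e2; ring].
have [v3 v4] : v 0 3 = 0 /\ v 0 4 = 0.
  apply: (@solve2 _ _ (alpha * f * b + beta * g * q)
    (beta / 2 * (q ^+ 2 + zeta ^+ 2)) (beta / 2 * g ^+ 2)).
  - by move: D0; congr (_ != 0); field.
  - by move: (vM 3); rewrite mxE big_ord6 !mxE /= => <-; ring.
  - by move: (vM 4); rewrite mxE big_ord6 !mxE /= => <-; ring.
have [v0 v1] : v 0 0 = 0 /\ v 0 1 = 0.
  apply: (@solve2 _ _ (alpha * f * b)
    (alpha / 2 * (b ^+ 2 + eta ^+ 2)) (alpha / 2 * f ^+ 2)).
  - have -> : (alpha * f * b) ^+ 2
        - alpha / 2 * (b ^+ 2 + eta ^+ 2) * (alpha / 2 * f ^+ 2)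
        = (alpha * f / 2) ^+ 2 * (3 * b ^+ 2 - eta ^+ 2) by field.
    by rewrite mulf_neq0 ?subr_eq0 // expf_neq0 // !mulf_neq0 //
      invr_eq0 pnatr_eq0.
  - by move: (vM 0); rewrite mxE big_ord6 !mxE /= v3 v4 => <-; ring.
  - by move: (vM 1); rewrite mxE big_ord6 !mxE /= v3 v4 => <-; ring.
rewrite [v]row_sum_delta big_ord6 v0 v1 v3 v4 !scale0r !add0r !addr0.
by apply: addmx_sub; apply: scalemx_sub; rewrite -addsmxE;
  [exact: addsmxSl | exact: addsmxSr].
Qed.

Theorem mainTheorem1 (R : realType) (alpha beta : R)
    (alpha_gt0 : 0 < alpha) (beta_gt0 : 0 < beta)
    (f b eta g q zeta : R) :
  let A := flux_jacobian alpha beta (vec6 f b eta g q zeta) in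
  let normb := Num.sqrt (b ^+ 2 + eta ^+ 2) in
  let normq := Num.sqrt (q ^+ 2 + zeta ^+ 2) in
  let sigma := alpha * f * b + beta * g * q in
  let delta_p := beta * g * q + alpha * f / 2 * normb in
  let delta_m := beta * g * q - alpha * f / 2 * normb in
  let Delta_p := delta_p ^+ 2 - beta ^+ 2 * g ^+ 2 / 4 * normq ^+ 2 in
  let Delta_m := delta_m ^+ 2 - beta ^+ 2 * g ^+ 2 / 4 * normq ^+ 2 in
  let Delta_0 := sigma ^+ 2 - beta ^+ 2 * g ^+ 2 / 4 * normq ^+ 2 in
  [/\ (* (i) *)
      char_poly A =
        \prod_(l <- [:: alpha * f * b + alpha * f / 2 * normb;
                        alpha * f * b - alpha * f / 2 * normb;
                        sigma + beta * g / 2 * normq;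
                        sigma - beta * g / 2 * normq;
                        0; 0]) ('X - l%:P),
      (* (ii) *)
      Delta_0 != 0 -> 0 < f -> normb != 0 -> 3 * b ^+ 2 != eta ^+ 2 ->
        geometric_multiplicity A 0 = 2%N
    & (* (iii) *)
      0 < f -> 0 < g -> normb != 0 -> normq != 0 ->
      Delta_p != 0 -> Delta_m != 0 -> Delta_0 != 0 ->
      3 * b ^+ 2 != eta ^+ 2 ->
        (exists2 v : 6.-tuple 'cV[R]_6,
           free v &
           forall i : 'I_6, exists l : R,
             A *m tnth v i = l *: tnth v i)
        /\ diagonalizable A].
Proof.
move=> A normb normq sigma delta_p delta_m Delta_p Delta_m Delta_0.
have normbE : normb ^+ 2 = b ^+ 2 + eta ^+ 2.
  by rewrite sqr_sqrtr // addr_ge0 // sqr_ge0.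
have normqE : normq ^+ 2 = q ^+ 2 + zeta ^+ 2.
  by rewrite sqr_sqrtr // addr_ge0 // sqr_ge0.
have AE : A = flux_matrix alpha beta f b eta g q zeta by exact: flux_jacobianE.
have charA := char_poly_flux_matrix alpha beta f g normbE normqE.
rewrite -AE -/sigma in charA.
have rank0 : Delta_0 != 0 -> 0 < f -> 3 * b ^+ 2 != eta ^+ 2 ->
    \rank (eigenspace A 0) = 2%N.
  move=> D0 f0 be; rewrite /eigenspace raddf0 subr0 AE.
  apply: rank_ker_flux_matrix => //; first by rewrite gt_eqF.
    by rewrite gt_eqF.
  by rewrite -normqE.
split; first exact: charA.
  by move=> D0 f0 _ be; rewrite geometric_multiplicity_eigenspace rank0.
move=> f0 g0 nb0 nq0 Dp Dm D0 be.
suff diagA : diagonalizable A.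
  by split; first exact: diagonalizable_col_eigenvectors.
pose l1 := alpha * f * b + alpha * f / 2 * normb.
pose l2 := alpha * f * b - alpha * f / 2 * normb.
pose l3 := sigma + beta * g / 2 * normq.
pose l4 := sigma - beta * g / 2 * normq.
have eig l : l \in [:: l1; l2; l3; l4] -> (0 < \rank (eigenspace A l))%N.
  move=> l_in; rewrite lt0n mxrank_eq0 -/(eigenvalue A l).
  rewrite eigenvalue_root_char charA root_prod_XsubC.
  by rewrite (mem_cat l [:: l1; l2; l3; l4] [:: 0; 0]) l_in.
have n12 : l1 - l2 != 0.
  rewrite (_ : l1 - l2 = alpha * f * normb); last by rewrite /l1 /l2; field.
  by rewrite !mulf_neq0 // gt_eqF.
have n34 : l3 - l4 != 0.
  rewrite (_ : l3 - l4 = beta * g * normq); last by rewrite /l3 /l4; field.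
  by rewrite !mulf_neq0 // gt_eqF.
(* The two factors are [delta_m] plus and minus [beta * g / 2 * normq]; for [l2] below, [delta_p]
   takes the place of [delta_m]. *)
have /[!mulf_eq0] /[!negb_or] /andP[n31 n41] : (l3 - l1) * (l4 - l1) != 0.
  move: Dm; congr (_ != 0).
  by rewrite /l1 /l3 /l4 /Delta_m /delta_m /sigma; field.
have /[!mulf_eq0] /[!negb_or] /andP[n32 n42] : (l3 - l2) * (l4 - l2) != 0.
  move: Dp; congr (_ != 0).
  by rewrite /l2 /l3 /l4 /Delta_p /delta_p /sigma; field.
have /[!mulf_eq0] /[!negb_or] /andP[n30 n40] : l3 * l4 != 0.
  move: D0; congr (_ != 0).
  by rewrite /l3 /l4 /Delta_0; field.
have /[!mulf_eq0] /[!negb_or] /andP[n10 n20] : l1 * l2 != 0.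
  rewrite (_ : l1 * l2 = (alpha * f / 2) ^+ 2 * (3 * b ^+ 2 - eta ^+ 2)).
    rewrite mulf_neq0 ?subr_eq0 // expf_neq0 //.
    by rewrite !mulf_neq0 ?invr_eq0 ?pnatr_eq0 // gt_eqF.
  transitivity ((alpha * f / 2) ^+ 2 * (4 * b ^+ 2 - normb ^+ 2)).
    by rewrite /l1 /l2; field.
  by rewrite normbE; ring.
apply: (@diagonalizable_geometric_multiplicity _ _ A [:: 0; l1; l2; l3; l4]).
  rewrite !subr_eq0 in n12 n34 n31 n41 n32 n42.
  rewrite /= !inE !negb_or ![0 == _]eq_sym ![l1 == l3]eq_sym ![l1 == l4]eq_sym.
  rewrite ![l2 == l3]eq_sym ![l2 == l4]eq_sym.
  by rewrite n10 n20 n30 n40 n12 n34 n31 n41 n32 n42.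
(* The count is [2 + 1 + 1 + 1 + 1 = 6], with the double eigenvalue [0] listed once. *)
rewrite !big_cons big_nil rank0 // addn0.
apply: (@leq_add 2 4) => //; apply: (@leq_add 1 3);
  [|apply: (@leq_add 1 2); [|apply: (@leq_add 1 1)]];
  by apply: eig; rewrite !inE eqxx ?orbT.
Qed.
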